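(* Let $n\ge1$, $I=\{1,\dots,n\}$, and let $l>0$ be an integer. In type $A_n$, for any $m_1,m_2,\dots,m_l\in\mathbb{Z}$ and any $p_1,p_2,\dots,p_l\in I$, the product $$\mathcal{M}(Y_{p_1}(m_1))\cdot\mathcal{M}(Y_{p_2}(m_2))\cdots\mathcal{M}(Y_{p_l}(m_l))$$ holds a crystal structure (induced from $\mathcal{M}$).
   Context: Type $A_n$: $I=\{1,\dots,n\}$, with fundamental weights $\Lambda_i$ ($i\in I$). Monomial crystal. $\mathcal{M}$ is the set of Laurent monomials $M=\prod_{i\in I,\,k\in\mathbb{Z}}Y_i(k)^{y_i(k)}$ with $y_i(k)\in\mathbb{Z}$ vanishing for all but finitely many $(i,k)$. Put $Y_0(k)=Y_{n+1}(k)=1$ for all $k$, and $$A_i(k)=Y_i(k)\,Y_i(k+1)\,Y_{i-1}(k+1)^{-1}\,Y_{i+1}(k)^{-1}.$$ For $M=\prod_{i\in I,\,k\in\mathbb{Z}}Y_i(k)^{y_i(k)}\in\mathcal{M}$ set $wt(M)=\sum_i\big(\sum_k y_i(k)\big)\Lambda_i$, $\varphi_i(M)=\max\{\sum_{k\le l}y_i(k):l\in\mathbb{Z}\}$, $\varepsilon_i(M)=\max\{-\sum_{k>l}y_i(k):l\in\mathbb{Z}\}$. Set $\tilde f_iM=0$ if $\varphi_i(M)=0$, and otherwise $\tilde f_iM=A_i(n_f)^{-1}M$ with $n_f=\min\{l:\varphi_i(M)=\sum_{k\le l}y_i(k)\}$. Set $\tilde e_iM=0$ if $\varepsilon_i(M)=0$,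 and otherwise $\tilde e_iM=A_i(n_e)M$ with $n_e=\max\{l:\varphi_i(M)=\sum_{k\le l}y_i(k)\}$. These data make $\mathcal{M}$ a crystal. The crystal graph has an $i$-colored arrow $M\to M'$ iff $\tilde f_iM=M'$. For $p\in I$, $m\in\mathbb{Z}$, $\mathcal{M}(Y_p(m))$ denotes the connected component of $\mathcal{M}$ containing $Y_p(m)$. Product. For subsets $S_1,\dots,S_l\subset\mathcal{M}$, $S_1\cdots S_l=\{M_1\cdots M_l: M_j\in S_j\}\subset\mathcal{M}$. A subset $S\subset\mathcal{M}$ holds a crystal structure (induced from $\mathcal{M}$) if $\tilde e_iS\subset S\cup\{0\}$ and $\tilde f_iS\subset S\cup\{0\}$ for all $i\in I$; it is then a crystal with the restricted maps. *)

(* Defs.v *)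
From Stdlib Require Import Relation_Operators.
From mathcomp Require Import all_boot all_order all_algebra finmap.
From mathcomp Require Import boolp classical_sets cardinality fsbigop.
From mathcomp Require Import zify.
From mathcomp.multinomials Require Import monalg.

Set Implicit Arguments.
Unset Strict Implicit.
Unset Printing Implicit Defensive.

Import Order.TTheory GRing.Theory Num.Theory.

Local Open Scope classical_set_scope.
Local Open Scope ring_scope.

(* [xget 0 X] is an element of [X] if there is one; see [zmaxP] and [zminP]
   for the sets on which these are meaningful. *)
Definition zmax (A : set int) : int := xget 0 (A `&` ubound A).
Definition zmin (A : set int) : int := xget 0 (A `&` lbound A).

(* The Laurent monomial prod_(i,k) Y_i(k)^(y_i(k)) is its finitely supported
   family of exponents, [M@_(i, k)] being y_i(k). The monomials form an abelian
   group written additively: [M + N] is the product of M and N, [- M] the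
   inverse of M and [0] the monomial 1.
   The element [i : 'I_n] stands for the node i + 1 of the Dynkin diagram. *)
Notation monomial n := {malg int[('I_n * int)%type]}.

Section MonomialCrystal.

Variable n : nat.

Definition Y (i : 'I_n) (k : int) : monomial n := << (i, k) >>.

(* [Ynode j k] is Y_j(k) with the node j numbered from 1, and the trivial
   monomial when j = 0 or j = n + 1. *)
Definition Ynode (j : nat) (k : int) : monomial n :=
  if j is j'.+1 then (if insub j' is Some i then Y i k else 0) else 0.

(* A_i(k), where the nodes i - 1, i, i + 1 are numbered i, i.+1, i.+2. *)
Definition A (i : 'I_n) (k : int) : monomial n :=
  Ynode i.+1 k + Ynode i.+1 (k + 1) - Ynode i (k + 1) - Ynode i.+2 k.

Definition sum_le (i : 'I_n) (M : monomial n) (l : int) : int :=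
  \sum_(k \in [set k : int | (k <= l)%R]) M@_(i, k).

Definition sum_gt (i : 'I_n) (M : monomial n) (l : int) : int :=
  \sum_(k \in [set k : int | (l < k)%R]) M@_(i, k).

Definition phi (i : 'I_n) (M : monomial n) : int :=
  zmax (range (fun l => sum_le i M l)).

Definition eps (i : 'I_n) (M : monomial n) : int :=
  zmax (range (fun l => - sum_gt i M l)).

Definition n_f (i : 'I_n) (M : monomial n) : int :=
  zmin [set l | phi i M = sum_le i M l].

(* It is phi, not eps, that occurs here: the two functions that are maximised
   differ by a constant. *)
Definition n_e (i : 'I_n) (M : monomial n) : int :=
  zmax [set l | phi i M = sum_le i M l].

(* [None] is the extra element 0 of a crystal. *)
Definition ftilde (i : 'I_n) (M : monomial n) : option (monomial n) :=
  if phi i M == 0 then None else Some (- A i (n_f i M) + M).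

Definition etilde (i : 'I_n) (M : monomial n) : option (monomial n) :=
  if eps i M == 0 then None else Some (A i (n_e i M) + M).

Definition arrow (M M' : monomial n) : Prop :=
  exists i : 'I_n, ftilde i M = Some M'.

Definition component (M : monomial n) : set (monomial n) :=
  [set M' | clos_refl_sym_trans (monomial n) arrow M M'].

Definition prod_sets (l : nat) (S : 'I_l -> set (monomial n)) :
    set (monomial n) :=
  [set \sum_(j < l) F j | F in [set F : 'I_l -> monomial n |
                                forall j, S j (F j)]].

Definition holds_crystal_structure (S : set (monomial n)) : Prop :=
  forall i : 'I_n,
    etilde i @` S `<=` (Some @` S) `|` [set None] /\
    ftilde i @` S `<=` (Some @` S) `|` [set None].

End MonomialCrystal.

Lemma zmaxP (X : set int) : X !=set0 -> has_ubound X ->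
  X (zmax X) /\ ubound X (zmax X).
Proof.
move=> [x Xx] [b Xb].
suff [m Hm] : exists m, (X `&` ubound X) m by exact: (xgetPex 0 (ex_intro _ m Hm)).
apply: contrapT => noM.
have H k : exists2 y, X y & x + k%:Z <= y.
  elim: k => [|k [y Xy le]]; first by exists x => //; rewrite addr0.
  have [z Xz lt] : exists2 z, X z & y < z.
    apply: contrapT => nz; apply: noM; exists y; split => // z Xz.
    by rewrite leNgt; apply/negP => lt; apply: nz; exists z.
  by exists z => //; lia.
have [y Xy le] := H `|b - x|%N.+1.
by have := Xb y Xy; lia.
Qed.

Lemma zminP (X : set int) : X !=set0 -> has_lbound X ->
  X (zmin X) /\ lbound X (zmin X).
Proof.
move=> [x Xx] [b Xb].
suff [m Hm] : exists m, (X `&` lbound X) m by exact: (xgetPex 0 (ex_intro _ m Hm)).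
have [||] := @zmaxP [set - y | y in X]; first by exists (- x), x.
  by exists (- b) => _ [y /Xb le <-]; rewrite lerN2.
case=> m Xm <- ub; exists m; split => // z Xz.
by rewrite -lerN2; apply: ub; exists z.
Qed.

Section WellDefined.

Variables (n : nat) (i : 'I_n) (M : monomial n).

Let r : seq int := undup [seq x.2 | x <- msupp M].
Let y (k : int) : int := M@_(i, k).
Let total : int := \sum_(k <- r) y k.

Let sumE (D : set int) :
  \sum_(k \in D) M@_(i, k) = \sum_(k <- r | k \in D) y k.
Proof.
rewrite -(@fsbig_widen _ _ _ _ (D `&` [set` r])).
- rewrite fsbig_mkcondl -fsbig_seq ?undup_uniq//.
  by rewrite [RHS]big_mkcond.
- by move=> k [].
- move=> k [/= Dk nk]; apply/eqP; rewrite mcoeff_eq0; apply/negP => ks.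
  by apply: nk; split => //=; rewrite mem_undup; apply/mapP; exists (i, k).
Qed.

Lemma sum_leE l : sum_le i M l = \sum_(k <- r | k <= l) y k.
Proof. by rewrite /sum_le sumE; apply: eq_bigl => k; rewrite mem_setE. Qed.

Lemma sum_gtE l : sum_gt i M l = \sum_(k <- r | l < k) y k.
Proof. by rewrite /sum_gt sumE; apply: eq_bigl => k; rewrite mem_setE. Qed.

Let sum_le_gt l : - sum_gt i M l = sum_le i M l - total.
Proof.
rewrite sum_leE sum_gtE /total [in RHS](bigID (fun k => k <= l) xpredT) /=.
by rewrite opprD addrA subrr add0r; under eq_bigl do rewrite ltNge.
Qed.

Let sum_le_ub l : sum_le i M l <= \sum_(k <- r) `|y k|.
Proof.
rewrite sum_leE big_mkcond; apply: ler_sum => k _.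
by case: ifP => _; rewrite ?ler_norm.
Qed.

Let N : int := \sum_(k <- r) `|k|.

Let leN k : k \in r -> `|k| <= N.
Proof.
move=> kr; rewrite /N (big_rem k)//= lerDl.
by apply: sumr_ge0.
Qed.

Let sum_le_low l : l < - N -> sum_le i M l = 0.
Proof.
move=> lN; rewrite sum_leE big1_seq// => k /andP[kl /leN kN].
by exfalso; lia.
Qed.

Let sum_le_high l : N <= l -> sum_le i M l = total.
Proof.
move=> lN; rewrite sum_leE /total big_seq_cond [RHS]big_seq_cond.
apply: eq_bigl => k; rewrite andbT; case: (boolP (k \in r)) => //= /leN kN.
by lia.
Qed.

Lemma phiP : (exists l, phi i M = sum_le i M l) /\
  forall l, sum_le i M l <= phi i M.
Proof.
have [||[l _ lE] ub] := @zmaxP (range (fun l => sum_le i M l)).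
- by exists (sum_le i M 0), 0.
- by exists (\sum_(k <- r) `|y k|) => _ [l _ <-].
by split; [exists l; rewrite lE | move=> l'; apply: (ub (sum_le i M l')); exists l'].
Qed.

Lemma epsP : (exists l, eps i M = - sum_gt i M l) /\
  forall l, - sum_gt i M l <= eps i M.
Proof.
have [||[l _ lE] ub] := @zmaxP (range (fun l => - sum_gt i M l)).
- by exists (- sum_gt i M 0), 0.
- by exists (\sum_(k <- r) `|y k| - total) => _ [l _ <-]; rewrite sum_le_gt lerD2r.
by split; [exists l; rewrite lE | move=> l'; apply: (ub (- sum_gt i M l')); exists l'].
Qed.

Lemma phi_ge0 : 0 <= phi i M.
Proof. by rewrite -(@sum_le_low (- N - 1)); [case: phiP | lia]. Qed.

Lemma phi_eps : phi i M - eps i M = total.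
Proof.
have [[l pl] pub] := phiP; have [[l' el] eub] := epsP.
have := pub l'; have := eub l; move: el; rewrite !sum_le_gt; lia.
Qed.

Lemma n_fP : phi i M <> 0 ->
  phi i M = sum_le i M (n_f i M) /\
  forall l, phi i M = sum_le i M l -> n_f i M <= l.
Proof.
move=> p0; have [[l pl] _] := phiP.
have [||H lb] := @zminP [set l | phi i M = sum_le i M l].
- by exists l.
- exists (- N) => k /= pk; rewrite leNgt; apply/negP => /sum_le_low s0.
  by apply: p0; rewrite pk.
by split.
Qed.

Lemma n_eP : eps i M <> 0 ->
  phi i M = sum_le i M (n_e i M) /\
  forall l, phi i M = sum_le i M l -> l <= n_e i M.
Proof.
move=> e0; have [[l pl] _] := phiP.
have [||H ub] := @zmaxP [set l | phi i M = sum_le i M l].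
- by exists l.
- exists N => k /= pk; rewrite leNgt; apply/negP => /ltW/sum_le_high s0.
  by apply: e0; have := phi_eps; lia.
by split.
Qed.

End WellDefined.

(* Main.v *)
Require Import Defs.
From Stdlib Require Import Relation_Operators.
From mathcomp Require Import all_boot all_order all_algebra finmap.
From mathcomp Require Import classical_sets zify.
From mathcomp.multinomials Require Import monalg.

Set Implicit Arguments.
Unset Strict Implicit.
Unset Printing Implicit Defensive.

Import Order.TTheory GRing.Theory Num.Theory.

Local Open Scope ring_scope.

(** The operators [ftilde i] and [etilde i] only look at the exponents of the
    variables [Y_i(k)], and in a monomial [M] of a component [M(Y_p(m))] these
    are as simple as possible: for each [i] at most one of them is nonzero, and
    it is [1] or [-1].  This gives the theorem at once.  Let [M] be a product of
    monomials [M_j] of such components, with [phi i M > 0].  By minimality of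
    [n_f], the exponent of [Y_i(n_f)] in [M] is positive, so it is positive in
    some factor [M_j].  Then [Y_i(n_f)] is the only variable of color [i] in
    [M_j], so [ftilde i M_j] is [A_i(n_f)^-1 M_j], and [ftilde i M] is obtained
    from [M] by replacing [M_j] with an element of the same component.
    Likewise, when [eps i M > 0], the exponent of [Y_i(n_e + 1)] is negative in
    [M], hence in some [M_j], and [ftilde i] sends [A_i(n_e) M_j] back to
    [M_j].

    The description of the component comes from columns [j_1 < ... < j_p] in
    [{1, ..., n + 1}]: such a column stands for the monomial
    [X_(j_1)(m + p - 1) ... X_(j_p)(m)] with
    [X_j(k) = Y_j(k) Y_(j-1)(k + 1)^-1].  Put
    [h j := m + #{a | j_a > j}].  The factors telescope, and what remains is
    the product over [i] of [Y_i(h i)] to the power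
    [h (i - 1) + h (i + 1) - 2 h i].  So the monomial is encoded by the
    staircase function [h], which goes down by [0] or [1] at each step; its
    second difference is therefore [-1], [0] or [1], and applying [ftilde i] or
    its inverse moves the single value [h i] up or down by one
    ([column_lower], [column_raise]).  Hence the monomials of this form are
    stable along the arrows of the crystal graph in both directions, and they
    contain the component of [Y_p(m)] ([component_column]). *)

(** * Exponents and partial sums *)

Definition exponent (n : nat) (i : 'I_n) (M : monomial n) (k : int) : int :=
  M@_(i, k).

Lemma exponentD (n : nat) (i : 'I_n) (M N : monomial n) (k : int) :
  exponent i (M + N) k = exponent i M k + exponent i N k.
Proof. exact: mcoeffD. Qed.

Lemma exponentN (n : nat) (i : 'I_n) (M : monomial n) (k : int) :
  exponent i (- M) k = - exponent i M k.
Proof. exact: mcoeffN. Qed.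

Lemma sum_le_step (n : nat) (i : 'I_n) (M : monomial n) (l : int) :
  sum_le i M l = sum_le i M (l - 1) + exponent i M l.
Proof.
rewrite /exponent !sum_leE; set r := undup _.
have -> : M@_(i, l) = \sum_(k <- r | k == l) M@_(i, k).
  have [lr|lr] := boolP (l \in r).
    by rewrite -big_filter filter_pred1_uniq ?undup_uniq// big_seq1.
  rewrite big1_seq => [|k /andP[/eqP -> kr]]; last by rewrite kr in lr.
  apply/eqP; rewrite mcoeff_eq0; apply: contra lr => ls.
  by rewrite mem_undup; apply/mapP; exists (i, l).
rewrite [LHS](bigID (fun k => k == l)) /= addrC; congr (_ + _).
  by apply: eq_bigl => k; lia.
by apply: eq_bigl => k; lia.
Qed.

(** Before [n_f] the partial sums have not reached their maximum. *)
Lemma exponent_n_f_gt0 (n : nat) (i : 'I_n) (M : monomial n) :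
  phi i M <> 0 -> 0 < exponent i M (n_f i M).
Proof.
move=> /n_fP[pE pmin]; have [_ pub] := phiP i M.
have := pub (n_f i M - 1); have := pmin (n_f i M - 1).
have := sum_le_step i M (n_f i M); lia.
Qed.

Lemma exponent_n_fS_le0 (n : nat) (i : 'I_n) (M : monomial n) :
  phi i M <> 0 -> exponent i M (n_f i M + 1) <= 0.
Proof.
move=> /n_fP[pE _]; have [_ pub] := phiP i M.
have := pub (n_f i M + 1); have := sum_le_step i M (n_f i M + 1).
rewrite addrK; lia.
Qed.

(** After [n_e] the partial sums have left their maximum. *)
Lemma exponent_n_eS_lt0 (n : nat) (i : 'I_n) (M : monomial n) :
  eps i M <> 0 -> exponent i M (n_e i M + 1) < 0.
Proof.
move=> /n_eP[pE pmax]; have [_ pub] := phiP i M.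
have := pub (n_e i M + 1); have := pmax (n_e i M + 1).
have := sum_le_step i M (n_e i M + 1); rewrite addrK; lia.
Qed.

(** The partial sums jump from [0] to [1] at [k], so [phi] is [1] and [n_f]
    is [k]. *)
Lemma ftilde_single (n : nat) (i : 'I_n) (M : monomial n) (k : int) :
  (forall q, exponent i M q = (q == k)%:R) -> ftilde i M = Some (- A i k + M).
Proof.
move=> Mk.
have kr : k \in undup [seq x.2 | x <- msupp M].
  rewrite mem_undup; apply/mapP; exists (i, k) => //.
  by rewrite -mcoeff_neq0 -/(exponent i M k) Mk eqxx oner_eq0.
have sumE l : sum_le i M l = (k <= l)%R%:R.
  rewrite sum_leE big_mkcond (bigD1_seq k) ?undup_uniq//=.
  rewrite -/(exponent i M k) Mk eqxx big1.
    by rewrite addr0; case: ifP.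
  by move=> q /negPf qk; rewrite -/(exponent i M q) Mk qk; case: ifP.
have [[l0 pl0] pub] := phiP i M.
have phi1 : phi i M = 1.
  by have := pub k; move: pl0; rewrite !sumE; case: (k <= l0); lia.
have [|fE fmin] := @n_fP n i M; first by rewrite phi1.
have -> : k = n_f i M; last by rewrite /ftilde phi1.
have := fmin k; move: fE; rewrite phi1 !sumE lexx.
by case: (boolP (k <= n_f i M)); lia.
Qed.

Lemma exponent_Y (n : nat) (i j : 'I_n) (k q : int) :
  exponent j (Y i k) q = ((i == j) && (k == q))%:R.
Proof. by rewrite /exponent /Y mcoeffU. Qed.

Lemma exponent_Ynode (n : nat) (j : nat) (k : int) (i : 'I_n) (q : int) :
  exponent i (Ynode n j k) q = ((j == i.+1) && (k == q))%:R.
Proof.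
case: j => [|j] /=; first by rewrite /exponent mcoeff0.
case: insubP => [u _ uj|]; first by rewrite exponent_Y -uj.
have := ltn_ord i; rewrite /exponent mcoeff0 eqSS.
by case: eqP => [->|//] ->.
Qed.

Lemma exponent_A (n : nat) (i : 'I_n) (k : int) (j : 'I_n) (q : int) :
  exponent j (A i k) q = ((i == j :> nat) && (k == q))%:R
    + ((i == j :> nat) && (k + 1 == q))%:R
    - ((i == j.+1 :> nat) && (k + 1 == q))%:R
    - ((i.+1 == j :> nat) && (k == q))%:R.
Proof. by rewrite /A !(exponentD, exponentN) !exponent_Ynode !eqSS. Qed.

(** * Column monomials *)

(** [h] is the staircase function of a column, at the node [i + 1] numbered by
    [i : 'I_n]. Beyond [n + 1] it can be continued by a constant, so asking for
    the steps to be [0] or [1] at all [j] spares a range condition. *)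
Definition column (n : nat) (M : monomial n) : Prop :=
  exists2 h : nat -> int, (forall j, h j.+1 <= h j <= h j.+1 + 1) &
    forall (i : 'I_n) k, exponent i M k =
      if k == h i.+1 then h i + h i.+2 - h i.+1 *+ 2 else 0.

(** This is the column [1, ..., p + 1], as [p] stands for the node [p + 1]. *)
Lemma column_Y (n : nat) (p : 'I_n) (m : int) : column (Y p m).
Proof.
exists (fun j => m + (p.+1 - j)%N%:Z) => [j|i k]; first lia.
rewrite exponent_Y -val_eqE /=.
case: (ltngtP p i) => pi /=; do ?case: ifP; do ?case: eqP; lia.
Qed.

Lemma column_exponent_gt0 (n : nat) (M : monomial n) (i : 'I_n) (k : int) :
  column M -> 0 < exponent i M k -> forall q, exponent i M q = (q == k)%:R.
Proof.
move=> [h hh Mh]; rewrite Mh; case: eqP => [->|//] pos q.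
rewrite Mh; case: eqP => // _.
by have := hh i; have := hh i.+1; lia.
Qed.

Lemma column_exponent_lt0 (n : nat) (M : monomial n) (i : 'I_n) (k : int) :
  column M -> exponent i M k < 0 -> forall q, exponent i M q = - (q == k)%:R.
Proof.
move=> [h hh Mh]; rewrite Mh; case: eqP => [->|//] neg q.
rewrite Mh; case: eqP => // _.
by have := hh i; have := hh i.+1; lia.
Qed.

(** The second difference of [h] is positive at a node, that is [1], only if
    [h] goes down by one before the node and is constant after it; then its
    value there can be increased by one. *)
Lemma column_lower (n : nat) (M : monomial n) (i : 'I_n) (k : int) :
  column M -> 0 < exponent i M k -> column (- A i k + M).
Proof.
move=> [h hh Mh]; rewrite Mh; case: eqP => [->|//] pos.
have h0 := hh i; have h1 := hh i.+1.
exists (fun j => h j + (j == i.+1 :> nat)%:R) => [j|j q].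
  have := hh j.
  have [ji|] := eqVneq j i; first by subst j; lia.
  by have [ji|] := eqVneq j i.+1; first (subst j; lia); lia.
rewrite exponentD exponentN exponent_A Mh.
have := hh j; have := hh j.+1.
have [ij|nij] := eqVneq (i : nat) j.
  rewrite -ij; do !case: eqP => //=; lia.
have [ij|nij1] := eqVneq (i : nat) j.+1.
  move: h0 h1 pos; rewrite ij; do !case: eqP => //=; lia.
have [ij|nij2] := eqVneq (i.+1 : nat) j.
  move: h0 h1 pos; rewrite -ij; do !case: eqP => //=; lia.
do !case: eqP => //=; lia.
Qed.

(** Dual to [column_lower]: the value of [h] at the node decreases by one. *)
Lemma column_raise (n : nat) (M : monomial n) (i : 'I_n) (k : int) :
  column M -> exponent i M (k + 1) < 0 -> column (A i k + M).
Proof.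
move=> [h hh Mh]; rewrite Mh; case: eqP => [kh|//] neg.
have h0 := hh i; have h1 := hh i.+1.
exists (fun j => h j - (j == i.+1 :> nat)%:R) => [j|j q].
  have := hh j.
  have [ji|] := eqVneq j i; first by subst j; lia.
  by have [ji|] := eqVneq j i.+1; first (subst j; lia); lia.
rewrite exponentD exponent_A Mh.
have := hh j; have := hh j.+1.
have [ij|nij] := eqVneq (i : nat) j.
  rewrite -ij; do !case: eqP => //=; lia.
have [ij|nij1] := eqVneq (i : nat) j.+1.
  move: h0 h1 neg kh; rewrite ij; do !case: eqP => //=; lia.
have [ij|nij2] := eqVneq (i.+1 : nat) j.
  move: h0 h1 neg kh; rewrite -ij; do !case: eqP => //=; lia.
do !case: eqP => //=; lia.
Qed.

(** * Stability along arrows *)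

(** Backwards along [M -> M'], the exponent of [Y_i(n_f + 1)] is at most [0]
    in [M] by maximality at [n_f], hence negative in [M' = A_i(n_f)^-1 M]. *)
Lemma arrow_column (n : nat) (M M' : monomial n) :
  arrow M M' -> column M <-> column M'.
Proof.
case=> i; rewrite /ftilde; case: eqP => // p0 [<-].
split=> [cM|cM']; first exact/column_lower/exponent_n_f_gt0.
rewrite -(addKr (- A i (n_f i M)) M) opprK.
apply: column_raise => //.
rewrite exponentD exponentN exponent_A eqxx.
have := exponent_n_fS_le0 p0; do !case: eqP => //=; lia.
Qed.

Lemma component_column (n : nat) (p : 'I_n) (m : int) (M : monomial n) :
  component (Y p m) M -> column M.
Proof.
move=> cM; suff [H _] : column (Y p m) <-> column M by exact/H/column_Y.
elim: cM => [x y /arrow_column//|//|x y _ [H1 H2]|x y z _ [H1 H2] _ [H3 H4]].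
  by split.
by split=> [/H1/H3|/H4/H2].
Qed.

Lemma component_lower (n : nat) (p i : 'I_n) (m k : int) (M : monomial n) :
  component (Y p m) M -> 0 < exponent i M k -> component (Y p m) (- A i k + M).
Proof.
move=> cM pos; apply: (rst_trans _ _ _ _ _ cM); apply: rst_step; exists i.
apply: ftilde_single => q.
exact: (column_exponent_gt0 (component_column cM) pos).
Qed.

(** [A_i(k)] turns the only variable [Y_i(k + 1)^-1] of color [i] in [M] into
    [Y_i(k)], so that [ftilde i] leads back to [M]. *)
Lemma component_raise (n : nat) (p i : 'I_n) (m k : int) (M : monomial n) :
  component (Y p m) M -> exponent i M (k + 1) < 0 ->
  component (Y p m) (A i k + M).
Proof.
move=> cM neg; apply: (rst_trans _ _ _ _ _ cM).
apply/rst_sym/rst_step; exists i.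
rewrite -[in RHS](addKr (A i k) M); apply: ftilde_single => q.
have Mq := column_exponent_lt0 (component_column cM) neg q.
rewrite exponentD exponent_A Mq eqxx; do !case: eqP => //=; lia.
Qed.

(** * Products *)

Lemma prod_sets_add (n l : nat) (S : 'I_l -> set (monomial n))
    (F : 'I_l -> monomial n) (j : 'I_l) (B : monomial n) :
  (forall j, S j (F j)) -> S j (B + F j) ->
  prod_sets S (B + \sum_(j < l) F j).
Proof.
move=> SF SB; exists (fun j' => if j' == j then B + F j else F j').
  by move=> j' /=; case: eqP => [->|].
rewrite (bigD1 j)//= eqxx [in RHS](bigD1 j)//= addrA; congr (_ + _).
by apply: eq_bigr => j' /negPf ->.
Qed.

Lemma exponent_sum_gt0 (n l : nat) (i : 'I_n)
    (F : 'I_l -> monomial n) (k : int) :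
  0 < exponent i (\sum_(j < l) F j) k -> exists j, 0 < exponent i (F j) k.
Proof.
rewrite /exponent raddf_sum /= => pos; apply/existsP; apply: contraLR pos.
rewrite negb_exists -leNgt => /forallP le0.
by apply: sumr_le0 => j _; rewrite leNgt.
Qed.

Lemma exponent_sum_lt0 (n l : nat) (i : 'I_n)
    (F : 'I_l -> monomial n) (k : int) :
  exponent i (\sum_(j < l) F j) k < 0 -> exists j, exponent i (F j) k < 0.
Proof.
rewrite /exponent raddf_sum /= => neg; apply/existsP; apply: contraLR neg.
rewrite negb_exists -leNgt => /forallP ge0.
by apply: sumr_ge0 => j _; rewrite leNgt.
Qed.

Theorem corollary5p3 (n : nat) (hn : (1 <= n)%N) (l : nat) (hl : (0 < l)%N)
    (m : 'I_l -> int) (p : 'I_l -> 'I_n) :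
  holds_crystal_structure
    (prod_sets (fun j : 'I_l => component (Y (p j) (m j)))).
Proof.
move=> i; split=> _ [_ [F SF <-] <-]; rewrite /etilde /ftilde.
  case: eqP => [_|/exponent_n_eS_lt0/exponent_sum_lt0[j Fj]]; first by right.
  left; eexists; last reflexivity.
  by apply: (@prod_sets_add _ _ _ _ j) => //; apply: component_raise.
case: eqP => [_|/exponent_n_f_gt0/exponent_sum_gt0[j Fj]]; first by right.
left; eexists; last reflexivity.
by apply: (@prod_sets_add _ _ _ _ j) => //; apply: component_lower.
Qed.
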